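(* Let $n\ge 2$, $i\in\{0,\ldots,n-1\}$, and let $h$ be a Hamiltonian cycle of $Q_n$. Among the edges of $h$ that are $i$-th dimension edges, exactly half have $i$-parity $0$ and exactly half have $i$-parity $1$. Equivalently, half of the $i$-th dimension edges of $h$ lie in the $0$-bipartition class of $\mathcal{D}_{in}$ and half lie in the $1$-bipartition class.
   Context: $Q_n$ is the hypercube on $\{0,1\}^n$ (coordinates indexed $0,\ldots,n-1$), vertices adjacent iff they differ in exactly one coordinate. An $i$-th dimension edge is an edge $\{u,u+e_i\}$ ($e_i$ the $i$-th basis vector, addition mod 2). For $v\in\{0,1\}^n$, $\mathrm{par}_{in}(v)$ is the number of $1$'s among the coordinates of $v$ other than the $i$-th, taken mod 2; the $i$-parity of the edge $\{u,u+e_i\}$ is $\mathrm{par}_{in}(u)=\mathrm{par}_{in}(u+e_i)$. The graph $\mathcal{D}_{in}$ has the $i$-th dimension edges as vertices, two being adjacent iff they are opposite edges of a 4-cycle of $Q_n$; it is bipartite with $b$-bipartition class consisting of the $i$-th dimension edges of $i$-parity $b$, $b\in\{0,1\}$. *)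

(* Defs.v *)
From mathcomp Require Import all_boot.

Set Implicit Arguments.
Unset Strict Implicit.
Unset Printing Implicit Defensive.

Section Cycles.
Variables (T : finType) (r : rel T).
Implicit Types c : seq T.

(* Cycles of a graph are listed by their consecutive vertices; the length
   condition excludes a single edge traversed back and forth. *)
Definition is_cycle c : bool := (2 < size c) && ucycleb r c.

Definition is_hamiltonian_cycle c : bool :=
  is_cycle c && [forall v, v \in c].

Definition cycle_edges c : {set {set T}} :=
  [set [set v; next c v] | v in c].

Definition opposite_in_4cycle (e f : {set T}) : bool :=
  [exists a, exists b, exists c, exists d,
    [&& is_cycle [:: a; b; c; d], e == [set a; b] & f == [set c; d]]].

End Cycles.

Structure bipartite_graph (T : finType) := BipartiteGraph {
  bg_vertices : {set T};
  bg_adj : rel T;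
  bg_class : bool -> {set T};
  bg_adj_vertices : forall x y,
    bg_adj x y -> (x \in bg_vertices) && (y \in bg_vertices);
  bg_adj_sym : symmetric bg_adj;
  bg_cover : bg_class false :|: bg_class true = bg_vertices;
  bg_disjoint : [disjoint bg_class false & bg_class true];
  bg_bipartite : forall x y b,
    bg_adj x y -> x \in bg_class b -> y \in bg_class (~~ b) }.

(* {0,1}^n, with false as 0, true as 1 and (+) as addition mod 2. *)
Definition cube (n : nat) := {ffun 'I_n -> bool}.

Section Hypercube.
Variable n : nat.
Implicit Types (u v : cube n) (i j : 'I_n) (e f : {set cube n}) (b : bool).

Definition cube_adj : rel (cube n) :=
  fun u v => #|[set j | u j != v j]| == 1.

Definition add u v : cube n := [ffun j => u j (+) v j].
Definition basis i : cube n := [ffun j => j == i].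

Definition dim_edges i : {set {set cube n}} :=
  [set [set u; add u (basis i)] | u : cube n].

Definition par i v : bool := odd #|[set j | (j != i) && v j]|.

(* Both endpoints of an i-th dimension edge have the same parity (par_add), so
   on such an edge this is the common value (edge_parityE). *)
Definition edge_parity i e : bool := [exists u in e, par i u].

Lemma par_add i u : par i (add u (basis i)) = par i u.
Proof.
rewrite /par; congr (odd #|pred_of_set _|); apply/setP=> j.
by rewrite !inE !ffunE; case: eqP => //= _; rewrite addbF.
Qed.

Lemma edge_parityE i u : edge_parity i [set u; add u (basis i)] = par i u.
Proof.
apply/existsP/idP => [[v]|pu]; last by exists u; rewrite !inE eqxx.
by rewrite !inE => /andP[/orP[]/eqP->]; rewrite ?par_add.
Qed.

Lemma cube_adjP u v :
  reflect (exists j, v = add u (basis j)) (cube_adj u v).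
Proof.
apply: (iffP cards1P) => -[j].
  move=> /setP eq_uv; exists j; apply/ffunP=> k.
  by have := eq_uv k; rewrite !inE !ffunE => <-; case: (u k) (v k) => [] [].
move=> ->; exists j; apply/setP=> k.
by rewrite !inE !ffunE; case: (u k) (k == j) => [] [].
Qed.

Lemma addK u v : add (add u v) v = u.
Proof. by apply/ffunP=> k; rewrite !ffunE -addbA addbb addbF. Qed.

Lemma cube_adj_sym : symmetric cube_adj.
Proof.
by move=> u v; apply/cube_adjP/cube_adjP => -[j ->]; exists j; rewrite addK.
Qed.

Lemma par_addj i j u : j != i -> par i (add u (basis j)) = ~~ par i u.
Proof.
move=> ji; rewrite /par.
rewrite (cardsD1 j) [in RHS](cardsD1 j) !inE !ffunE eqxx ji /= !oddD.
have -> : [set k | (k != i) && add u (basis j) k] :\ j =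
          [set k | (k != i) && u k] :\ j.
  apply/setP=> k; rewrite !inE !ffunE.
  by case: (eqVneq k j) => //= _; rewrite addbF.
by case: (u j); case: (odd #|_|).
Qed.

Definition D_adj i : rel {set cube n} :=
  [rel e f | [&& e \in dim_edges i, f \in dim_edges i
               & opposite_in_4cycle cube_adj e f]].

Definition D_class i b : {set {set cube n}} :=
  [set e in dim_edges i | edge_parity i e == b].

Lemma D_adj_vertices i e f :
  D_adj i e f -> (e \in dim_edges i) && (f \in dim_edges i).
Proof. by case/and3P=> -> ->. Qed.

Lemma opposite_sym e f :
  opposite_in_4cycle cube_adj e f -> opposite_in_4cycle cube_adj f e.
Proof.
case/existsP=> a /existsP[b /existsP[c /existsP[d /and3P[cyc ee ef]]]].
apply/existsP; exists c; apply/existsP; exists d.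
apply/existsP; exists a; apply/existsP; exists b.
rewrite ee ef !andbT; move: cyc; rewrite /is_cycle /= /ucycleb.
by rewrite -(rot_cycle 2) -(rot_uniq 2).
Qed.

Lemma D_adj_sym i : symmetric (D_adj i).
Proof.
move=> e f; apply/and3P/and3P=> -[-> -> o]; split=> //; exact: opposite_sym.
Qed.

Lemma D_cover i : D_class i false :|: D_class i true = dim_edges i.
Proof.
by apply/setP=> e; rewrite !inE -andb_orr; case: edge_parity; rewrite andbT.
Qed.

Lemma D_disjoint i : [disjoint D_class i false & D_class i true].
Proof.
apply/pred0P=> e; rewrite /= !inE.
by case: edge_parity; rewrite ?andbF.
Qed.

Lemma dim_edge_pair i u v : u != v ->
  [set u; v] \in dim_edges i -> v = add u (basis i).
Proof.
move=> uv /imsetP[w _ /setP eq_e].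
move: (eq_e u) (eq_e v); rewrite !inE !eqxx orbT /= => /esym/orP[]/eqP eu.
- by move=> /esym/orP[]/eqP ev; [case/eqP: uv|]; rewrite eu ev.
- by move=> /esym/orP[]/eqP ev; [|case/eqP: uv]; rewrite eu ev ?addK.
Qed.

Lemma D_bipartite i e f b :
  D_adj i e f -> e \in D_class i b -> f \in D_class i (~~ b).
Proof.
case/and3P=> eD fD /existsP[u /existsP[v /existsP[w /existsP[x]]]].
case/and3P=> /andP[_ /andP[]] /= /and5P[_ vw _ _ _].
rewrite !inE !negb_or => /and4P[/and3P[uv uw _] /andP[_ _] wx _].
move=> /eqP eE /eqP fE; subst e f.
have ev := dim_edge_pair uv eD; have ex := dim_edge_pair wx fD.
case/cube_adjP: vw => j ew.
have ji : j != i by apply: contra uw => /eqP ji; rewrite ew ji ev addK.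
rewrite eD fD /= {}ex edge_parityE ew par_addj // ev par_add edge_parityE.
by move/eqP->.
Qed.

Definition D i : bipartite_graph {set cube n} :=
  BipartiteGraph (@D_adj_vertices i) (@D_adj_sym i) (D_cover i) (D_disjoint i)
    (@D_bipartite i).

End Hypercube.

(* Main.v *)
Require Import Defs.
From mathcomp Require Import all_boot.

Set Implicit Arguments.
Unset Strict Implicit.
Unset Printing Implicit Defensive.

(* Let V_b be the set of vertices with par_i = b, A_b the vertices of V_b that h
   leaves along an i-th dimension edge, and B_b the other vertices of V_b. Every
   step of h keeps par_i along i-th dimension edges and flips it otherwise, so
   the vertices whose successor lies in V_b are those of A_b and B_(~~ b). The
   successor map is a bijection, hence |A_b| + |B_b| = |A_b| + |B_(~~ b)| and
   |B_0| = |B_1|. As n >= 2 gives |V_0| = |V_1|, also |A_0| = |A_1|; and A_b is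
   in bijection with the i-th dimension edges of h of i-parity b. *)

(** Rotated to start at [x], the cycle reads [x], [y], [z], ..., so the second successor of [x] is
    the third entry [z], and uniqueness separates it from [x]. *)
Lemma next2_neq (T : eqType) (c : seq T) x :
  uniq c -> 2 < size c -> x \in c -> next c (next c x) != x.
Proof.
move=> Uc lt2c /rot_to[k p Ec].
rewrite -!(next_rot k Uc) Ec.
move: lt2c Uc; rewrite -(size_rot k) -(rot_uniq k) Ec.
case: p {Ec} => [|y [|z p]] //= _; rewrite !inE !negb_or eqxx.
by case/andP=> /and3P[xy xz _] _; rewrite [y == x]eq_sym (negPf xy) eqxx eq_sym.
Qed.

(** Two distinct vertices giving the same edge would be each other's successors, against
    [next2_neq]. *)
Lemma next_edge_inj (T : finType) (c : seq T) :
  uniq c -> 2 < size c -> {in c &, injective (fun v => [set v; next c v])}.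
Proof.
move=> Uc lt2c v w vc wc /setP eq_e.
move: (eq_e v) (eq_e w); rewrite !inE !eqxx /=.
case/esym/orP=> [/eqP //|/eqP ev] /orP[/eqP //|/eqP ew].
by case/eqP: (next2_neq Uc lt2c vc); rewrite -ew -ev.
Qed.

Lemma add_basis_neq n (u : cube n) j : u != add u (basis j).
Proof.
apply/eqP=> /ffunP/(_ j); rewrite !ffunE eqxx.
by case: (u j).
Qed.

(** Adding a basis vector in a direction [j] other than [i], which exists as [n] is at least 2,
    swaps the two parity classes. *)
Lemma card_par n (i : 'I_n) b :
  2 <= n -> #|[set v | par i v == b]| = #|[set v | par i v == ~~ b]|.
Proof.
move=> lt1n; have [j ji] : exists j, j != i.
  apply/existsP; apply: contraLR lt1n => /existsPn iP.
  rewrite -leqNgt -[n]card_ord; apply/card_le1P=> j _ k.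
  by rewrite !inE (eqP (negbNE (iP j))) (eqP (negbNE (iP k))) eqxx.
have addI : injective (@add n ^~ (basis j)).
  by apply: (can_inj (g := @add n ^~ (basis j))) => u; apply: addK.
rewrite -[LHS](card_preimset _ addI).
by apply: eq_card => v; rewrite !inE par_addj //; case: par b => [] [].
Qed.

Section HamiltonianCycle.
Variables (n : nat) (i : 'I_n) (h : seq (cube n)).
Hypotheses (n_ge2 : 2 <= n) (hamh : is_hamiltonian_cycle (@cube_adj n) h).

Let Uh : uniq h. Proof. by case/andP: hamh => /andP[_ /andP[]]. Qed.
Let lt2h : 2 < size h. Proof. by case/andP: hamh => /andP[]. Qed.
Let memh v : v \in h. Proof. by case/andP: hamh => _ /forallP. Qed.

Let next_add v : exists j, next h v = add v (basis j).
Proof.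
apply/cube_adjP; apply: next_cycle (memh v).
by case/andP: hamh => /andP[_ /andP[]].
Qed.

Definition leaves_along : pred (cube n) :=
  [pred v | next h v == add v (basis i)].

Lemma par_next v : par i (next h v) = par i v (+) ~~ leaves_along v.
Proof.
rewrite /leaves_along /=; have [->|] := eqVneq; first by rewrite par_add addbF.
have [j ->] := next_add v; rewrite addbT => ne_ji.
by rewrite par_addj //; apply: contra ne_ji => /eqP->.
Qed.

Lemma card_leaves_along b :
  #|[set v | leaves_along v & par i v == b]| =
  #|[set v | leaves_along v & par i v == ~~ b]|.
Proof.
pose A (c : bool) := [set v | leaves_along v & par i v == c].
pose B (c : bool) := [set v | ~~ leaves_along v & par i v == c].
have cardV (c : bool) : #|[set v | par i v == c]| = #|A c| + #|B c|.
  rewrite -(cardsID [set v | leaves_along v]); congr (_ + _);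
  by apply: eq_card => v; rewrite !inE 1?andbC.
have cardN (c : bool) : #|[set v | par i v == c]| = #|A c| + #|B (~~ c)|.
  (* [next h] is injective, with left inverse [prev h], so the class is counted through its
     preimage. *)
  rewrite -[LHS](card_preimset _ (can_inj (prev_next Uh))).
  rewrite -(cardsID [set v | leaves_along v]); congr (_ + _);
  apply: eq_card => v; rewrite !inE par_next /leaves_along /=;
  by case: (_ == _ :> cube n); case: (par i v); case: c.
have eqB : #|B b| = #|B (~~ b)|.
  by apply/eqP; rewrite -(eqn_add2l #|A b|) -cardV cardN.
have := card_par i b n_ge2; rewrite !cardV eqB => /eqP.
by rewrite eqn_add2r => /eqP.
Qed.

Lemma cycle_edges_parity b :
  [set e in cycle_edges h :&: dim_edges i | edge_parity i e == b] =
  [set [set v; next h v] | v in [set v | leaves_along v & par i v == b]].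
Proof.
apply/setP=> e; rewrite inE [e \in _ :&: _]inE; apply/idP/imsetP.
  case/andP=> /andP[/imsetP[v _ ->] eD] eb.
  (* Two distinct ends of an edge of [dim_edges i] differ by [basis i], so [h] leaves [v] in
     direction [i]. *)
  exists v => //; have ne : v != next h v.
    by have [j ->] := next_add v; apply: add_basis_neq.
  move: eb; rewrite inE /leaves_along /= (dim_edge_pair ne eD) eqxx.
  by rewrite edge_parityE.
case=> v; rewrite inE => /andP[/= /eqP Nv vb] ->.
rewrite (imset_f (fun v => [set v; next h v]) (memh v)) /= Nv edge_parityE vb andbT.
by apply/imsetP; exists v.
Qed.

Lemma card_cycle_edges_parity b :
  2 * #|[set e in cycle_edges h :&: dim_edges i | edge_parity i e == b]|
    = #|cycle_edges h :&: dim_edges i|.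
Proof.
have cardE c : #|[set e in cycle_edges h :&: dim_edges i
                    | edge_parity i e == c]| =
               #|[set v | leaves_along v & par i v == c]|.
  rewrite cycle_edges_parity card_in_imset // => v w _ _.
  exact: next_edge_inj.
(* One of the two equal summands is traded for the count at [~~ b]; the sum then splits all these
   edges by parity. *)
rewrite mul2n -addnn {2}cardE card_leaves_along -cardE.
rewrite -[RHS](cardsID [set e | edge_parity i e == b]).
congr (_ + _); apply: eq_card => e; rewrite !inE //.
by rewrite andbC; case: edge_parity b => [] [].
Qed.

End HamiltonianCycle.

Theorem theorem2 (n : nat) (i : 'I_n) (h : seq (cube n)) :
  2 <= n ->
  is_hamiltonian_cycle (@cube_adj n) h ->
  (forall b : bool,
     2 * #|[set e in cycle_edges h :&: dim_edges i | edge_parity i e == b]|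
       = #|cycle_edges h :&: dim_edges i|)
  /\
  (forall b : bool,
     2 * #|cycle_edges h :&: bg_class (D i) b|
       = #|cycle_edges h :&: bg_vertices (D i)|).
Proof.
move=> n_ge2 hamh; split=> b; first exact: card_cycle_edges_parity.
(* The classes of [D i] are cut out of [dim_edges i] by parity, so this is the first claim
   regrouped. *)
rewrite -[RHS](card_cycle_edges_parity i n_ge2 hamh b); congr (2 * _).
by apply: eq_card => e; rewrite !inE andbA.
Qed.
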